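(* Let $t \geq 4$ and $m \geq 1$ be integers. Then there exists an infinite set of primes, having positive density within the set of all primes, such that for every prime $p$ in this set the projective norm graph $\mathcal{P}(p,t)$ contains a copy of the complete bipartite graph $K_{t-1,m}$ (as a subgraph).
   Context: For $t \geq 3$ and a prime power $q$, the projective norm graph $\mathcal{P}(q,t)$ is the graph with vertex set $\mathbb{F}_{q^{t-1}} \times \mathbb{F}_q^*$, in which two distinct vertices $(\alpha,a)$ and $(\beta,b)$ are adjacent if and only if $N(\alpha+\beta) = ab$, where $N$ denotes the norm map of the field extension $\mathbb{F}_{q^{t-1}}/\mathbb{F}_q$. A set of primes has density $\delta$ if the proportion of primes up to $x$ that lie in it tends to $\delta$ as $x \to \infty$. *)

(* Defs.v *)
From HB Require Import structures.
From mathcomp Require Import all_boot all_order all_algebra all_fingroup.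
From mathcomp Require Import all_solvable all_field.
From mathcomp Require Import all_classical all_reals all_analysis.

Set Implicit Arguments.
Unset Strict Implicit.
Unset Printing Implicit Defensive.

Import Order.TTheory GRing.Theory Num.Theory.
Import numFieldNormedType.Exports.

Local Open Scope ring_scope.

(* For F of order q and \dim {:L} = t - 1 this is the graph P(q, t).  The
   extension L / F of finite fields is Galois, so galNorm 1 {:L}, the product
   of the conjugates, is the field norm; it takes its values in F%:A.
   {unit F} is the type of nonzero elements of F, with val the injection. *)
Definition proj_norm_adj (F : finFieldType) (L : splittingFieldType F) :
    rel (L * {unit F}) :=
  fun u v => (u != v) &&
    (galNorm 1 {:L} (u.1 + v.1) == (val u.2 * val v.2)%:A).

Definition complete_bipartite (s m : nat) : rel ('I_s + 'I_m) :=
  fun x y => match x, y with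
             | inl _, inr _ | inr _, inl _ => true
             | _, _ => false
             end.

(* Not necessarily induced. *)
Definition contains_subgraph (V W : Type) (G : rel V) (H : rel W) : Prop :=
  exists f : W -> V, injective f /\ (forall x y, H x y -> G (f x) (f y)).

Definition count_upto (A : set nat) (n : nat) : nat :=
  count (fun k => k \in A) (iota 0 n.+1).

Definition primes_set : set nat := [set p | prime p]%classic.

(* The terms n < 2, where no prime is <= n, have the junk value 0 / 0 = 0. *)
Definition has_prime_density (R : realType) (S : set nat) (delta : R) : Prop :=
  ((fun n : nat => (count_upto (S `&` primes_set) n)%:R
                   / (count_upto primes_set n)%:R : R)
     @ \oo --> delta)%classic.

(* Main.v *)
(** All sufficiently large primes work, so the density is 1.  Let s = t - 1 and
    fix s distinct elements alpha_i of the extension L of F_q.  A pair (beta, b)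
    with beta different from all +- alpha_i determines the tuple
    a_i = N(alpha_i + beta) / b of nonzero elements of F_q, and (beta, b) is
    then a common neighbour of the vertices (alpha_i, a_i).  There are at least
    (q^s - 2s)(q - 1) such pairs but only (q - 1)^s tuples, so for q > m + 2s
    some tuple arises from more than m pairs. *)

Require Import Defs.
From HB Require Import structures.
From mathcomp Require Import all_boot all_order all_algebra all_fingroup.
From mathcomp Require Import all_solvable all_field.
From mathcomp Require Import all_classical all_reals all_analysis.

Set Implicit Arguments.
Unset Strict Implicit.
Unset Printing Implicit Defensive.

Import Order.TTheory GRing.Theory Num.Theory.
Import numFieldNormedType.Exports.

Local Open Scope ring_scope.

(** The fibres of [g] partition [D]; if each had at most [m] elements, then [D] would have at most
    [m * #|U|]. *)
Lemma pigeonhole_fiber (T U : finType) (D : {set T}) (g : T -> U) (m : nat) :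
  (m * #|U| < #|D|)%N -> exists y, (m < #|[set x in D | g x == y]|)%N.
Proof.
move=> mU; apply/existsP; apply: contraLR mU; rewrite negb_exists -leqNgt.
move=> /forallP small; rewrite -sum1_card (partition_big g predT) //= mulnC.
rewrite -sum_nat_const; apply: leq_sum => y _.
by rewrite sum1dep_card leqNgt small.
Qed.

(** The extension is Galois, so the norm lands in the base field, and it vanishes only at 0. *)
Lemma galNorm_unit (F : finFieldType) (L : splittingFieldType F) (x : L) :
  x != 0 -> exists u : {unit F}, galNorm 1 {:L} x = (val u)%:A.
Proof.
move=> x0; have /vlineP[k Nk] : galNorm 1 {:L} x \in 1%VS.
  by rewrite mem_galNorm ?memvf// finField_galois ?subvf.
have k0 : k \is a GRing.unit.
  rewrite unitfE; apply: contra_neq x0 => k0.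
  by apply/eqP; rewrite -(galNorm_eq0 1 {:L}) Nk k0 scale0r.
by exists (FinRing.Unit k0).
Qed.

Lemma proj_norm_contains_bipartite (F : finFieldType)
    (L : splittingFieldType F) (m : nat) :
  (m + 2 * \dim {:L} < #|F|)%N ->
  contains_subgraph (@proj_norm_adj F L) (@complete_bipartite (\dim {:L}) m).
Proof.
set s := \dim {:L}; set q := #|F| => hq.
have s_gt0 : (0 < s)%N by exact: adim_gt0.
(* [V] is [L] seen as a finite type, so that its elements can be counted and enumerated. *)
pose V := finvect_type L.
have cardV : #|{: V}| = (q ^ s)%N.
  transitivity #|({:V}%VS : {vspace V})|; last exact: card_vspace.
  by apply: eq_card => v; rewrite memvf.
have q_gt1 : (1 < q)%N by exact: finNzRing_gt1.
have le_sV : (s <= #|{: V}|)%N by rewrite cardV ltnW// ltn_expl.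
pose al (i : 'I_s) : V := enum_val (widen_ord le_sV i).
have al_inj : injective al.
  by move=> i j /enum_val_inj /(congr1 val) /= /ord_inj.
(* [nu] is the norm with values in the unit group; its value at 0 is arbitrary. *)
have /choice[nu nuP] : forall x : L, exists u : {unit F},
    x != 0 -> galNorm 1 {:L} x = (val u)%:A.
  move=> x; have [->|x0] := eqVneq x 0; first by exists 1%g.
  by have [u Nu] := galNorm_unit x0; exists u.
(* Avoiding every [al i] keeps the two sides of the bipartite graph disjoint; avoiding every
   [- al i] keeps the norms nonzero. *)
pose bad : {set V} := al @: 'I_s :|: [set - al i | i : 'I_s].
pose D : {set V * {unit F}} := finset.setX (~: bad) [set: {unit F}].
pose g (x : V * {unit F}) : {ffun 'I_s -> {unit F}} :=
  [ffun i => (nu (al i + x.1)%R * x.2^-1)%g].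
have cardU : #|{: {unit F}}| = q.-1 by rewrite -cardsT card_finField_unit.
have card_bad : (#|bad| <= 2 * s)%N.
  rewrite (leq_trans (leq_card_setU _ _))// mul2n -addnn.
  by rewrite leq_add// (leq_trans (leq_imset_card _ _))// card_ord.
(* This is the pigeonhole inequality with a common factor q - 1 cancelled. It follows from m (q -
   1)^(s-1) + 2s <= (m + 2s) q^(s-1) < q^s. *)
have card_good : (m * q.-1 ^ s.-1 < #|~: bad|)%N.
  rewrite cardsCs finset.setCK cardV ltn_subRL.
  apply: (@leq_ltn_trans ((m + 2 * s) * q ^ s.-1)); last first.
    by rewrite -[in ltnRHS](prednK s_gt0) expnS ltn_pmul2r// expn_gt0 ltnW.
  rewrite addnC mulnDl leq_add//.
    rewrite leq_mul2l; case: s.-1 => [|k]; rewrite ?orbT//.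
    by rewrite leq_exp2r// leq_pred orbT.
  by rewrite (leq_trans card_bad)// leq_pmulr// expn_gt0 ltnW.
have card_D : (m * #|{: {ffun 'I_s -> {unit F}}}| < #|D|)%N.
  rewrite card_ffun card_ord cardU cardsX cardsT cardU.
  rewrite -[in ltnLHS](prednK s_gt0) expnSr mulnA ltn_pmul2r//.
  by rewrite -subn1 subn_gt0.
(* The tuple [y] gives the second coordinates on the side of size [s]; [be] lists [m] points of its
   fibre as the other side. *)
have [y lt_m] := pigeonhole_fiber g card_D.
pose be (j : 'I_m) : V * {unit F} := enum_val (widen_ord (ltnW lt_m) j).
have be_inj : injective be.
  by move=> i j /enum_val_inj /(congr1 val) /= /ord_inj.
have beP j : be j \in [set x in D | g x == y] by exact: enum_valP.
have adj i j : al i != (be j).1 /\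
    galNorm 1 {:L} ((al i : L) + (be j).1) = (val (y i) * val (be j).2)%:A.
  have := beP j; rewrite inE => /andP[]; rewrite !inE andbT negb_or.
  move=> /andP[bal bNal] /eqP <-; split.
    by apply: contraNneq bal => <-; exact: imset_f.
  rewrite nuP; last first.
    apply: contra bNal => /eqP /addr0_eq <-.
    by rewrite -[al i]opprK; apply/imsetP; exists i => //; rewrite opprK.
  by rewrite -FinRing.val_unitM ffunE mulgKV.
exists (fun x => match x with inl i => (al i : L, y i) | inr j => be j end).
have neq i j : (al i : L, y i) != be j.
  by apply: contraNneq (adj i j).1 => <-.
split=> [[i|j] [i'|j']|[i|j] [i'|j']] //=.
- by move=> [/al_inj->].
- by move=> e; move: (neq i j'); rewrite e eqxx.
- by move=> e; move: (neq i' j); rewrite e eqxx.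
- by move=> /be_inj->.
- by rewrite /proj_norm_adj neq /= (adj i j').2 eqxx.
- by rewrite /proj_norm_adj eq_sym neq /= addrC (adj i' j).2 mulrC eqxx.
Qed.

Lemma unbounded_infinite_set (A : set nat) :
  (forall n, exists2 k, (n < k)%N & A k) -> infinite_set A.
Proof.
move=> Aoo /finite_seqP[s As]; have [k] := Aoo (\max_(i <- s) i)%N.
rewrite As /= => lt_k ks; suff : (k <= \max_(i <- s) i)%N by rewrite leqNgt lt_k.
exact: leq_bigmax_seq.
Qed.

(** By Euclid there is a prime beyond any bound, and each one raises the count by 1. *)
Lemma count_upto_primes_cvgy :
  (count_upto primes_set n @[n --> \oo] --> \oo)%classic.
Proof.
have piS n : count_upto primes_set n.+1 = (count_upto primes_set n + prime n.+1)%N.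
  have <- : (n.+1 \in primes_set) = prime n.+1 by apply/idP/idP; rewrite inE.
  by rewrite /count_upto -[n.+2]addn1 iotaD count_cat /= addn0.
have mono a b : (a <= b)%N -> (count_upto primes_set a <= count_upto primes_set b)%N.
  move=> ab; apply: (homo_leq leqnn leq_trans) ab.
  by move=> n; rewrite piS leq_addr.
apply/cvgnyPge; elim=> [|M [n _ Mn]]; first exact: nearW.
have [[//|p] lt_np p_prime] := prime_above n.
exists p.+1 => // k /= /mono; apply: leq_trans.
by rewrite piS p_prime addn1 ltnS Mn.
Qed.

(** At most [N] primes lie outside [S], so the ratio is squeezed between 1 - N / pi(n) and 1, where
    pi(n) tends to infinity. *)
Lemma cofinite_prime_density (R : realType) (S : set nat) (N : nat) :
  (forall p, prime p -> (N <= p)%N -> S p) -> has_prime_density S (1 : R).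
Proof.
move=> SN.
pose pi n := count_upto primes_set n.
pose sg n := count_upto (S `&` primes_set) n.
have le_sg n : (sg n <= pi n)%N.
  by apply: sub_count => k /=; rewrite !inE => -[].
have le_pi n : (pi n <= sg n + N)%N.
  have lt_N : (count (fun k => k < N) (iota 0 n.+1) <= N)%N.
    rewrite -size_filter -[leqRHS](size_iota 0); apply: uniq_leq_size.
      by rewrite filter_uniq// iota_uniq.
    by move=> k; rewrite mem_filter !mem_iota => /andP[-> _].
  apply: leq_trans (leq_add (leqnn _) lt_N).
  rewrite -count_predUI (leq_trans _ (leq_addr _ _))//.
  apply: sub_count => k /= /set_mem k_prime.
  case: (ltnP k N) => Nk; rewrite ?orbT ?orbF//.
  by apply/mem_set; split => //; exact: SN.
have pi_oo : ((fun n => (pi n)%:R : R) @ \oo --> +oo)%classic.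
  exact/cvgrnyP/count_upto_primes_cvgy.
have pi_gt0 : (\forall n \near \oo, 0 < (pi n)%:R :> R)%classic.
  have /cvgnyPge/(_ 1%N) := count_upto_primes_cvgy.
  by apply: filterS => n; rewrite ltr0n.
apply: (@squeeze_cvgr _ _ _ _ (fun n => 1 - N%:R * (pi n)%:R^-1) (fun=> 1)).
- near=> n; have pn : 0 < (pi n)%:R :> R by near: n.
  rewrite ler_pdivrMr// mul1r ler_nat le_sg andbT.
  rewrite -[X in X - _](@divff _ (pi n)%:R) ?gt_eqF// -mulrBl.
  by rewrite ler_pM2r ?invr_gt0// lerBlDr -natrD ler_nat.
- rewrite -[X in (_ --> X)%classic]subr0 -(mulr0 N%:R).
  apply: cvgB; first exact: cvg_cst.
  apply: cvgMr; exact/(gtr0_cvgV0 pi_gt0).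
- exact: cvg_cst.
Unshelve. all: by end_near.
Qed.

Theorem theorem3 (R : realType) (t m : nat) (ht : (4 <= t)%N) (hm : (1 <= m)%N) :
  exists (S : set nat) (delta : R),
    [/\ (S `<=` primes_set)%classic,
        infinite_set S,
        (0 < delta)%R,
        has_prime_density S delta &
        forall p : nat, S p ->
          forall L : splittingFieldType 'F_p, \dim {:L} = (t - 1)%N ->
            contains_subgraph (@proj_norm_adj _ L)
                              (@complete_bipartite (t - 1) m)].
Proof.
(* The successor turns [N <= p] into the strict bound on the field order needed for the
   embedding. *)
pose N := (m + 2 * (t - 1)).+1.
exists [set p | prime p /\ (N <= p)%N]%classic, 1; split => //.
- by move=> p [].
- apply: unbounded_infinite_set => n.
  have [p] := prime_above (n + N); rewrite -addSn => lt_p p_prime.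
  exists p; last split=> //.
    exact: leq_trans (leq_addr _ _) lt_p.
  exact: leq_trans (leq_addl _ _) lt_p.
- exact: (@cofinite_prime_density _ _ N).
- move=> p [p_prime Np] L dimL; rewrite -dimL.
  by apply: proj_norm_contains_bipartite; rewrite dimL card_Fp.
Qed.
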